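(* Let $K$ be a field, let $X=\{x_i \mid i\in I\}$ be a set of variables (the index set $I$ not necessarily finite), and let $(q_{ij})_{i,j\in I}$ be nonzero elements of $K$ with $q_{ii}=1$ and $q_{ij}=q_{ji}^{-1}$ for all $i,j\in I$. Let $K_q[X]$ be the $K$-algebra generated by $X$ subject to the relations $x_ix_j=q_{ij}x_jx_i$ for all $i,j\in I$, and let $K_q[X,X^{-1}]$ be the $K$-algebra generated by the elements of $X$ and their inverses subject to the same relations. Then every $X$-inner automorphism $\sigma$ of $K_q[X]$ is induced by conjugation by some monomial $\Delta$ in $K_q[X,X^{-1}]$, that is, $s^\sigma=\Delta s\Delta^{-1}$ for all $s\in K_q[X]$. In particular, if $\Delta=x_{i_1}^{j_1}x_{i_2}^{j_2}\cdots x_{i_n}^{j_n}$ (with $i_1,\dots,i_n\in I$ and $j_1,\dots,j_n\in\mathbb{Z}$), then for all $k\in I$ $$x_k^\sigma=\gamma x_k,\qquad \text{where } \gamma=q_{i_1k}^{j_1}q_{i_2k}^{j_2}\cdots q_{i_nk}^{j_n}.$$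
   Context: For a prime ring $R$, $Q(R)$ denotes its symmetric Martindale quotient ring (the set of elements $q$ of the left Martindale quotient ring of $R$ for which there is a nonzero two-sided ideal $J$ of $R$ with $Jq\subseteq R$ and $qJ\subseteq R$), and $N(R)$ denotes the set of those $w\in Q(R)$ such that $wR=Rw$. An automorphism $\sigma$ of $R$ is called $X$-inner if there is a nonzero $w\in N(R)$ such that $r^\sigma w=wr$ for all $r\in R$. Here $r^\sigma$ denotes the image of $r$ under $\sigma$. (The ''$X$'' in ''$X$-inner'' is part of the terminology and unrelated to the set $X$ of variables.) *)

(* Defs.v *)
From HB Require Import structures.
From mathcomp Require Import all_boot all_order all_algebra.
From mathcomp Require Import boolp classical_sets.

Set Implicit Arguments.
Unset Strict Implicit.
Unset Printing Implicit Defensive.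

Import GRing.Theory.
Local Open Scope ring_scope.
Local Open Scope quotient_scope.
Local Open Scope classical_set_scope.

Section Martindale.
Variable R : pzRingType.

Definition nonzero_ideal (J : set R) : Prop :=
  [/\ J 0,
      forall x y, J x -> J y -> J (x + y),
      forall r x, J x -> J (r * x),
      forall x r, J x -> J (x * r)
    & exists2 x, J x & x != 0].

Definition prime_ring : Prop :=
  (1 != 0 :> R) /\
  (forall a b : R, (forall r, a * r * b = 0) -> a = 0 \/ b = 0).

(* An element of the left Martindale quotient ring is represented by a left
   R-linear map from a nonzero two-sided ideal J to R; [lm_fun] is total, but
   only its values on J are meaningful.  Maps act on the right: [j q] is the
   image of j. *)
Record lmart := LMart {
  lm_dom : set R;
  lm_fun :> R -> R;
  lm_ideal : nonzero_ideal lm_dom;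
  lm_add : forall x y, lm_dom x -> lm_dom y ->
             lm_fun (x + y) = lm_fun x + lm_fun y;
  lm_lin : forall r x, lm_dom x -> lm_fun (r * x) = r * lm_fun x
}.

(* Equality of elements of the left Martindale quotient ring, which is the
   quotient of [lmart] by this relation (an equivalence when R is prime, see
   [mart_eq_refl], [mart_eq_sym] and [mart_eq_trans]). *)
Definition mart_eq (f g : lmart) : Prop :=
  exists J : set R,
    [/\ nonzero_ideal J, J `<=` lm_dom f, J `<=` lm_dom g
      & forall x, J x -> f x = g x].

(* The elements a q and q a of the quotient ring, for a in R: the maps
   x |-> (x a) q and x |-> (x q) a. *)
Program Definition mart_lmul (a : R) (f : lmart) : lmart :=
  @LMart (lm_dom f) (fun x => f (x * a)) (lm_ideal f) _ _.
Next Obligation.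
case: (lm_ideal f) => _ _ _ Jr _.
by rewrite mulrDl (lm_add (Jr _ _ _) (Jr _ _ _)).
Qed.
Next Obligation.
case: (lm_ideal f) => _ _ _ Jr _.
by rewrite -mulrA (lm_lin _ (Jr _ _ _)).
Qed.

Program Definition mart_rmul (f : lmart) (a : R) : lmart :=
  @LMart (lm_dom f) (fun x => f x * a) (lm_ideal f) _ _.
Next Obligation. by rewrite lm_add // mulrDl. Qed.
Next Obligation. by rewrite lm_lin // mulrA. Qed.

(* r in R, viewed in the quotient ring, is right multiplication by r; it is
   defined on all of R, which is a nonzero ideal as soon as 1 <> 0. *)
Definition is_mart_of (r : R) (f : lmart) : Prop :=
  exists J : set R,
    [/\ nonzero_ideal J, J `<=` lm_dom f & forall x, J x -> f x = x * r].

Definition in_sym_mart (q : lmart) : Prop :=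
  exists J : set R, nonzero_ideal J /\
    forall j, J j ->
      (exists r, is_mart_of r (mart_lmul j q)) /\
      (exists r, is_mart_of r (mart_rmul q j)).

(* The set N(R): elements w of the symmetric quotient ring with wR = Rw. *)
Definition in_N (w : lmart) : Prop :=
  [/\ in_sym_mart w,
      forall r, exists r', mart_eq (mart_rmul w r) (mart_lmul r' w)
    & forall r, exists r', mart_eq (mart_lmul r w) (mart_rmul w r')].

Definition X_inner (sigma : R -> R) : Prop :=
  exists w : lmart,
    [/\ in_N w, ~ is_mart_of 0 w
      & forall r, mart_eq (mart_lmul (sigma r) w) (mart_rmul w r)].

Lemma mart_eq_refl f : mart_eq f f.
Proof. by exists (lm_dom f); split => //; exact: lm_ideal. Qed.

Lemma mart_eq_sym f g : mart_eq f g -> mart_eq g f.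
Proof. by case=> J [? ? ? e]; exists J; split => // x /e. Qed.

Lemma mart_eq_trans : prime_ring ->
  forall f g h, mart_eq f g -> mart_eq g h -> mart_eq f h.
Proof.
move=> [_ pR] f g h [J [iJ Jf Jg eJ]] [L [iL Lg Lh eL]].
exists (J `&` L); split; last first.
- by move=> x [Jx Lx]; rewrite eJ // eL.
- by move=> x [_ /Lh].
- by move=> x [/Jf].
case: iJ iL => [J0 JD Jl Jr [a Ja a0]] [L0 LD Ll Lr [b Lb b0]].
split=> [//|x y [? ?] [? ?]|r x [? ?]|x r [? ?]|].
- by split; [exact: JD|exact: LD].
- by split; [exact: Jl|exact: Ll].
- by split; [exact: Jr|exact: Lr].
apply: contrapT => nex.
case: (pR a b) => [r||]; last 2 first.
- by apply/eqP.
- by apply/eqP.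
apply: contrapT => /eqP arb0; apply: nex; exists (a * r * b) => //.
by split; [apply: (Jr); apply: (Jr)|apply: Ll].
Qed.

End Martindale.

Inductive expr (K G : Type) : Type :=
  | Gen of G
  | Scal of K
  | Add of expr K G & expr K G
  | Mul of expr K G & expr K G.
Arguments Gen {K G}.
Arguments Scal {K G}.

HB.instance Definition _ (K G : Type) := gen_eqMixin (expr K G).
HB.instance Definition _ (K G : Type) := gen_choiceMixin (expr K G).

Section Congruence.
Variables (K : fieldType) (G : Type).
Variable rel : expr K G -> expr K G -> Prop.

(* The least congruence containing [rel] whose quotient is a unital
   associative K-algebra; the constants [Scal c] become the scalars c. *)
Inductive cong : expr K G -> expr K G -> Prop :=
  | cong_rel a b : rel a b -> cong a b
  | cong_refl a : cong a a
  | cong_sym a b : cong a b -> cong b a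
  | cong_trans a b c : cong a b -> cong b c -> cong a c
  | cong_add a a' b b' : cong a a' -> cong b b' -> cong (Add a b) (Add a' b')
  | cong_mul a a' b b' : cong a a' -> cong b b' -> cong (Mul a b) (Mul a' b')
  | cong_addA a b c : cong (Add a (Add b c)) (Add (Add a b) c)
  | cong_addC a b : cong (Add a b) (Add b a)
  | cong_add0 a : cong (Add (Scal 0) a) a
  | cong_mulA a b c : cong (Mul a (Mul b c)) (Mul (Mul a b) c)
  | cong_mul1l a : cong (Mul (Scal 1) a) a
  | cong_mul1r a : cong (Mul a (Scal 1)) a
  | cong_mul0 a : cong (Mul (Scal 0) a) (Scal 0)
  | cong_mulDl a b c : cong (Mul (Add a b) c) (Add (Mul a c) (Mul b c))
  | cong_mulDr a b c : cong (Mul a (Add b c)) (Add (Mul a b) (Mul a c))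
  | cong_scalD x y : cong (Scal (x + y)) (Add (Scal x) (Scal y))
  | cong_scalM x y : cong (Scal (x * y)) (Mul (Scal x) (Scal y))
  | cong_scalC x a : cong (Mul (Scal x) a) (Mul a (Scal x)).

Definition congb (a b : expr K G) : bool := `[< cong a b >].

Lemma congb_equiv : equiv_class_of congb.
Proof.
split=> [a|a b|b a c].
- by apply/asboolP; exact: cong_refl.
- by apply/asboolP/asboolP; exact: cong_sym.
- by move=> /asboolP ab /asboolP bc; apply/asboolP; exact: cong_trans bc.
Qed.

Canonical congb_equivRel := EquivRelPack congb_equiv.

Definition presented : Type := {eq_quot congb_equivRel}.

HB.instance Definition _ := Choice.on presented.

Definition cls (a : expr K G) : presented := \pi_({eq_quot congb_equivRel}) a.
Definition rep (u : presented) : expr K G := @repr _ {eq_quot congb_equivRel} u.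

Lemma clsP a b : cls a = cls b <-> cong a b.
Proof. by split=> [/eqmodP/asboolP|?]; last exact/eqmodP/asboolP. Qed.

Lemma repK u : cls (rep u) = u.
Proof. exact: (@reprK _ {eq_quot congb_equivRel}). Qed.

Lemma rep_cls a : cong (rep (cls a)) a.
Proof. by apply/clsP; exact: repK. Qed.

Definition pgen (g : G) : presented := cls (Gen g).
Definition pscal (c : K) : presented := cls (Scal c).
Definition padd (u v : presented) : presented := cls (Add (rep u) (rep v)).
Definition pmul (u v : presented) : presented := cls (Mul (rep u) (rep v)).
Definition popp (u : presented) : presented := pmul (pscal (-1)) u.

Lemma paddE a b : padd (cls a) (cls b) = cls (Add a b).
Proof. by apply/clsP/cong_add; exact: rep_cls. Qed.
Lemma pmulE a b : pmul (cls a) (cls b) = cls (Mul a b).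
Proof. by apply/clsP/cong_mul; exact: rep_cls. Qed.

Lemma cls_ind (P : presented -> Prop) : (forall a, P (cls a)) -> forall u, P u.
Proof. by move=> h u; rewrite -(repK u). Qed.

Lemma paddA : associative padd.
Proof.
elim/cls_ind=> a; elim/cls_ind=> b; elim/cls_ind=> c.
by rewrite !paddE; apply/clsP; exact: cong_addA.
Qed.
Lemma paddC : commutative padd.
Proof.
by elim/cls_ind=> a; elim/cls_ind=> b; rewrite !paddE; apply/clsP/cong_addC.
Qed.
Lemma padd0 : left_id (pscal 0) padd.
Proof. by elim/cls_ind=> a; rewrite paddE; apply/clsP/cong_add0. Qed.
Lemma pmulA : associative pmul.
Proof.
elim/cls_ind=> a; elim/cls_ind=> b; elim/cls_ind=> c.
by rewrite !pmulE; apply/clsP; exact: cong_mulA.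
Qed.
Lemma pmul1l : left_id (pscal 1) pmul.
Proof. by elim/cls_ind=> a; rewrite pmulE; apply/clsP/cong_mul1l. Qed.
Lemma pmul1r : right_id (pscal 1) pmul.
Proof. by elim/cls_ind=> a; rewrite pmulE; apply/clsP/cong_mul1r. Qed.
Lemma pmul0 u : pmul (pscal 0) u = pscal 0.
Proof. by elim/cls_ind: u => a; rewrite pmulE; apply/clsP/cong_mul0. Qed.
Lemma pmulDl : left_distributive pmul padd.
Proof.
elim/cls_ind=> a; elim/cls_ind=> b; elim/cls_ind=> c.
by rewrite !(paddE, pmulE); apply/clsP; exact: cong_mulDl.
Qed.
Lemma pmulDr : right_distributive pmul padd.
Proof.
elim/cls_ind=> a; elim/cls_ind=> b; elim/cls_ind=> c.
by rewrite !(paddE, pmulE); apply/clsP; exact: cong_mulDr.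
Qed.
Lemma pscalD x y : pscal (x + y) = padd (pscal x) (pscal y).
Proof. by rewrite paddE; apply/clsP/cong_scalD. Qed.
Lemma pscalM x y : pscal (x * y) = pmul (pscal x) (pscal y).
Proof. by rewrite pmulE; apply/clsP/cong_scalM. Qed.
Lemma pscalC x u : pmul (pscal x) u = pmul u (pscal x).
Proof. by elim/cls_ind: u => a; rewrite !pmulE; apply/clsP/cong_scalC. Qed.
Lemma paddN : left_inverse (pscal 0) popp padd.
Proof.
by move=> u; rewrite /popp -{2}[u]pmul1l -pmulDl -pscalD addNr pmul0.
Qed.

HB.instance Definition _ :=
  GRing.isZmodule.Build presented paddA paddC padd0 paddN.
HB.instance Definition _ :=
  GRing.Zmodule_isPzRing.Build presented pmulA pmul1l pmul1r pmulDl pmulDr.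

Definition pscale (c : K) (u : presented) : presented := pscal c * u.

Lemma pscaleA a b v : pscale a (pscale b v) = pscale (a * b) v.
Proof. by rewrite /pscale mulrA [pscal (a * b)]pscalM. Qed.
Lemma pscale1 : left_id 1 pscale.
Proof. exact: pmul1l. Qed.
Lemma pscaleDr : right_distributive pscale +%R.
Proof. by move=> a u v; rewrite /pscale mulrDr. Qed.
Lemma pscaleDl v : {morph pscale^~ v : a b / a + b}.
Proof. by move=> a b; rewrite /pscale [pscal _]pscalD; exact: mulrDl. Qed.

HB.instance Definition _ :=
  GRing.Zmodule_isLmodule.Build K presented pscaleA pscale1 pscaleDr pscaleDl.

(* The library's [algType] structures demand 1 <> 0, which can fail for an
   arbitrary presentation, hence these two laws are stated as lemmas. *)
Lemma presented_scalerAl (c : K) (u v : presented) : c *: (u * v) = c *: u * v.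
Proof. exact: mulrA. Qed.
Lemma presented_scalerAr (c : K) (u v : presented) : c *: (u * v) = u * (c *: v).
Proof.
have e : c *: u = u * pscal c by exact: pscalC.
by rewrite presented_scalerAl e -mulrA.
Qed.

Lemma clsD a b : cls (Add a b) = cls a + cls b.
Proof. by rewrite -paddE. Qed.
Lemma clsM a b : cls (Mul a b) = cls a * cls b.
Proof. by rewrite -pmulE. Qed.
Lemma cls_scalM x a : cls (Mul (Scal x) a) = x *: cls a.
Proof. exact: clsM. Qed.
Lemma cls_scal x : cls (Scal x) = x *: (1 : presented).
Proof. by rewrite -[LHS]mulr1. Qed.

End Congruence.

Fixpoint expr_map (K G H : Type) (f : G -> H) (a : expr K G) : expr K H :=
  match a with
  | Gen g => Gen (f g)
  | Scal c => Scal c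
  | Add a b => Add (expr_map f a) (expr_map f b)
  | Mul a b => Mul (expr_map f a) (expr_map f b)
  end.

Section Quantum.
Variables (K : fieldType) (I : Type) (q : I -> I -> K).

Inductive qrel : expr K I -> expr K I -> Prop :=
  | qrel_comm i j :
      qrel (Mul (Gen i) (Gen j)) (Mul (Scal (q i j)) (Mul (Gen j) (Gen i))).

Definition quantum_poly := presented qrel.
HB.instance Definition _ := GRing.Lmodule.on quantum_poly.
HB.instance Definition _ := GRing.PzRing.on quantum_poly.

Definition qvar (i : I) : quantum_poly := pgen qrel i.

(* [inl i] stands for x_i and [inr i] for its inverse. *)
Inductive lrel : expr K (I + I) -> expr K (I + I) -> Prop :=
  | lrel_comm i j :
      lrel (Mul (Gen (inl i)) (Gen (inl j)))
           (Mul (Scal (q i j)) (Mul (Gen (inl j)) (Gen (inl i))))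
  | lrel_mulV i : lrel (Mul (Gen (inl i)) (Gen (inr i))) (Scal 1)
  | lrel_Vmul i : lrel (Mul (Gen (inr i)) (Gen (inl i))) (Scal 1).

Definition quantum_laurent := presented lrel.
HB.instance Definition _ := GRing.Lmodule.on quantum_laurent.
HB.instance Definition _ := GRing.PzRing.on quantum_laurent.

Definition lvar (i : I) : quantum_laurent := pgen lrel (inl i).
Definition lvarV (i : I) : quantum_laurent := pgen lrel (inr i).

Lemma qvarC i j : qvar i * qvar j = q i j *: (qvar j * qvar i).
Proof. by rewrite -!clsM -cls_scalM; apply/clsP/cong_rel/qrel_comm. Qed.
Lemma lvarC i j : lvar i * lvar j = q i j *: (lvar j * lvar i).
Proof. by rewrite -!clsM -cls_scalM; apply/clsP/cong_rel/lrel_comm. Qed.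
Lemma lvarK i : lvar i * lvarV i = 1.
Proof. by rewrite -!clsM; apply/clsP/cong_rel/lrel_mulV. Qed.
Lemma lvarVK i : lvarV i * lvar i = 1.
Proof. by rewrite -!clsM; apply/clsP/cong_rel/lrel_Vmul. Qed.

(* The canonical homomorphism K_q[X] -> K_q[X, X^-1] mapping x_i to x_i. *)
Definition qtoL (s : quantum_poly) : quantum_laurent :=
  cls lrel (expr_map inl (rep s)).

Lemma expr_map_cong a b :
  cong qrel a b -> cong lrel (expr_map inl a) (expr_map inl b).
Proof.
elim=> /=; first by move=> _ _ [i j]; apply/cong_rel/lrel_comm.
all: by eauto using cong.
Qed.

Lemma qtoLE a : qtoL (cls qrel a) = cls lrel (expr_map inl a).
Proof. exact/clsP/expr_map_cong/rep_cls. Qed.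

Lemma qtoL_var i : qtoL (qvar i) = lvar i.
Proof. exact: qtoLE. Qed.

Lemma qtoLZ c s : qtoL (c *: s) = c *: qtoL s.
Proof.
elim/cls_ind: s => a.
by rewrite -[c *: cls _ a]cls_scalM !qtoLE -[RHS]cls_scalM.
Qed.

Lemma qtoL_zmod_morphism : zmod_morphism qtoL.
Proof.
have addm u v : qtoL (u + v) = qtoL u + qtoL v.
  elim/cls_ind: u => a; elim/cls_ind: v => b.
  by rewrite -[cls _ a + cls _ b]clsD !qtoLE -[RHS]clsD.
move=> u v; rewrite addm; congr (_ + _).
by rewrite -scaleN1r qtoLZ scaleN1r.
Qed.

Lemma qtoL_monoid_morphism : monoid_morphism qtoL.
Proof.
split; first exact: qtoLE.
elim/cls_ind=> a; elim/cls_ind=> b.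
by rewrite -[cls _ a * cls _ b]clsM !qtoLE -[RHS]clsM.
Qed.

HB.instance Definition _ :=
  GRing.isZmodMorphism.Build quantum_poly quantum_laurent qtoL qtoL_zmod_morphism.
HB.instance Definition _ :=
  GRing.isMonoidMorphism.Build quantum_poly quantum_laurent qtoL
    qtoL_monoid_morphism.

Definition lvarX (i : I) (j : int) : quantum_laurent :=
  match j with Posz n => lvar i ^+ n | Negz n => lvarV i ^+ n.+1 end.

(* The sequence [:: (i_1, j_1); ...; (i_n, j_n)] encodes the monomial
   x_{i_1}^{j_1} ... x_{i_n}^{j_n}. *)
Definition lmon (l : seq (I * int)) : quantum_laurent :=
  \prod_(p <- l) lvarX p.1 p.2.

Definition lmonV (l : seq (I * int)) : quantum_laurent :=
  \prod_(p <- rev l) lvarX p.1 (- p.2).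

Lemma lvarXK i j : lvarX i j * lvarX i (- j) = 1.
Proof.
have c : GRing.comm (lvar i) (lvarV i) by rewrite /GRing.comm lvarK lvarVK.
case: j => [[|n]|n] /=; rewrite ?mulr1 //.
  by rewrite -exprMn_comm // lvarK expr1n.
by rewrite -exprMn_comm ?lvarVK ?expr1n //; exact/commr_sym.
Qed.

Lemma lmonK l : lmon l * lmonV l = 1.
Proof.
rewrite /lmon /lmonV; elim: l => [|p l IH]; first by rewrite !big_nil mulr1.
rewrite rev_cons -cats1 big_cat /= big_seq1 big_cons.
by rewrite -mulrA (mulrA (\prod_(_ <- l) _)) IH mul1r lvarXK.
Qed.

Lemma lmonVK l : lmonV l * lmon l = 1.
Proof.
rewrite /lmon /lmonV; elim: l => [|p l IH]; first by rewrite !big_nil mulr1.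
rewrite rev_cons -cats1 big_cat /= big_seq1 big_cons.
rewrite -mulrA (mulrA (lvarX p.1 (- p.2))).
by rewrite -{2}[p.2]opprK lvarXK mul1r IH.
Qed.

End Quantum.

(* Main.v *)
Require Import Defs.
From mathcomp Require Import all_boot all_order all_algebra.
From mathcomp Require Import finmap boolp wochoice.

(** An X-inner automorphism [sigma] is given by a partial map [w] on the ring R of
    quantum polynomials.  Evaluating [w] at one point of its domain replaces it by
    honest elements: there are nonzero [x], [y] in R and [x'] with [sigma x' = x]
    such that [x * sigma r * y = y * r * x'] for all [r]
    ([X_inner_intertwiner]).

    Fix a monomial order on exponents.  Comparing leading exponents for [r = 1] and
    for general [r] shows that [sigma] preserves leading exponents
    ([intertwiner_lead]).  The reversed order is again a monomial order, so
    [sigma] preserves lowest exponents as well, and it maps every monomial to a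
    scalar multiple of itself ([intertwiner_mono]).  Comparing leading coefficients
    in the equation for [r = x_k] then gives
    [sigma x_k = (comm_scalar t k / comm_scalar s k) x_k], where [s] and [t] are the
    leading words of [x] and [y] ([X_inner_diagonal]); this is the effect of
    conjugation by a monomial whose exponent is that of [t] minus that of [s]
    ([diagonal_conj]).

    For the formula with a given monomial Delta, conjugation by Delta multiplies x_k
    by the stated scalar in the Laurent algebra ([lmon_conj_var]), and the scalar is
    determined by its product with x_k because x_k is invertible and the Laurent
    algebra is not zero.

    Two facts support this: the monomials of R are linearly independent, and 1 is not
    0 in the Laurent algebra.  Both follow from an explicit action of the Laurent
    algebra on functions of finitely supported exponents, once the variables are
    totally ordered.  A well-order of the variables also yields the lexicographic
    monomial order, whatever the size of I. *)

Set Implicit Arguments.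
Unset Strict Implicit.
Unset Printing Implicit Defensive.

Import GRing.Theory.
Local Open Scope ring_scope.

(** * Scalars in the quantum polynomial and Laurent algebras *)

Section ScalarLaws.
Variables (K : fieldType) (I : Type) (q : I -> I -> K).

Lemma qpoly_scalerAl c (u v : quantum_poly q) : c *: u * v = c *: (u * v).
Proof. exact/esym/presented_scalerAl. Qed.
Lemma qpoly_scalerAr c (u v : quantum_poly q) : u * (c *: v) = c *: (u * v).
Proof. exact/esym/presented_scalerAr. Qed.
Lemma qlaurent_scalerAl c (u v : quantum_laurent q) : c *: u * v = c *: (u * v).
Proof. exact/esym/presented_scalerAl. Qed.
Lemma qlaurent_scalerAr c (u v : quantum_laurent q) : u * (c *: v) = c *: (u * v).
Proof. exact/esym/presented_scalerAr. Qed.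

End ScalarLaws.

(** * An action of the quantum Laurent algebra on functions of exponents *)

Section LaurentAction.
Variables (K : fieldType) (I : choiceType) (q : I -> I -> K) (lt : rel I).
Hypothesis q_neq0 : forall i j, q i j != 0.
Hypothesis q_diag : forall i, q i i = 1.
Hypothesis q_inv : forall i j, q i j = (q j i)^-1.
Hypothesis lt_asym : forall i j, lt i j -> lt j i = false.
Hypothesis lt_total : forall i j, i != j -> lt i j || lt j i.

Definition exponent := {fsfun I -> int with 0}.

Definition shift (i : I) (n : int) (a : exponent) : exponent :=
  [fsfun a with i |-> a i + n].

Lemma shiftE i n a j : shift i n a j = a j + (if j == i then n else 0).
Proof. by rewrite /shift fsfun_withE; case: eqP => [->|]; rewrite ?addr0. Qed.

Lemma shiftK i n a : shift i n (shift i (- n) a) = a.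
Proof.
by apply/fsfunP => j; rewrite !shiftE; case: eqP; rewrite ?addr0 // addrNK.
Qed.

Lemma shiftC i j m n a : shift i m (shift j n a) = shift j n (shift i m a).
Proof. by apply/fsfunP => k; rewrite !shiftE addrAC. Qed.

(** The scalar that appears when x_i is moved into its place in the ordered
    monomial of exponent [a], past all the smaller variables. *)
Definition twist (i : I) (a : exponent) : K :=
  \prod_(j <- finsupp a | lt j i) q i j ^ a j.

(** Two exponents have different supports; enlarging the index set makes their
    twists comparable factor by factor. *)
Lemma twist_supset i (a : exponent) (S : seq I) : uniq S ->
  {subset finsupp a <= S} -> twist i a = \prod_(j <- S | lt j i) q i j ^ a j.
Proof.
move=> uS aS; rewrite [RHS](bigID (fun j => a j != 0)) /= [X in _ * X]big1.
  rewrite mulr1 /twist -big_filter -[RHS]big_filter; apply: perm_big.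
  apply: uniq_perm; rewrite ?filter_uniq ?fset_uniq // => j.
  rewrite !mem_filter; case: (lt j i) => //=.
  rewrite -mem_finsupp; case: (boolP (j \in finsupp a)) => //= /aS -> //.
by move=> j /andP[_ /negPn/eqP->].
Qed.

Lemma twist_shift i j n a :
  twist i (shift j n a) = twist i a * (if lt j i then q i j ^ n else 1).
Proof.
pose S := undup (j :: finsupp a).
have uS : uniq S by exact: undup_uniq.
have aS : {subset finsupp a <= S}.
  by move=> k ka; rewrite mem_undup inE ka orbT.
have saS : {subset finsupp (shift j n a) <= S}.
  move=> k; rewrite mem_undup inE mem_finsupp shiftE.
  by case: (k == j) => //=; rewrite addr0 mem_finsupp.
rewrite (twist_supset _ uS aS) (twist_supset _ uS saS).
under eq_bigr => k _ do rewrite shiftE expfzDr //.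
rewrite big_split /=; congr (_ * _).
have jS : j \in S by rewrite mem_undup inE eqxx.
rewrite -big_filter; case: ifP => ji; last first.
  rewrite big1_seq // => k /andP[_]; rewrite mem_filter => /andP[ki _].
  by case: eqP ki ji => [->->|_ _ _] //; rewrite expr0z.
rewrite (bigD1_seq j) ?filter_uniq ?mem_filter ?ji //= eqxx big1 ?mulr1 //.
by move=> k /negPf->; rewrite expr0z.
Qed.

Lemma twist_neq0 i a : twist i a != 0.
Proof. by rewrite prodf_seq_neq0; apply/allP => j _; rewrite expfz_neq0 ?implybT. Qed.

Lemma lt_irr i : lt i i = false.
Proof. by case: (boolP (lt i i)) => // /[dup] /lt_asym ->. Qed.

(** The Laurent algebra acts on all functions of the exponent, finitely supported
    or not: x_i shifts the argument by the i-th unit vector and multiplies by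
    [twist i].  As [twist i] does not involve the i-th exponent, the operator is
    invertible. *)
Fixpoint ev (e : expr K (I + I)) (f : exponent -> K) : exponent -> K :=
  match e with
  | Gen (inl i) => fun a => twist i a * f (shift i (-1) a)
  | Gen (inr i) => fun a => (twist i a)^-1 * f (shift i 1 a)
  | Scal c => fun a => c * f a
  | Add e1 e2 => fun a => ev e1 f a + ev e2 f a
  | Mul e1 e2 => ev e1 (ev e2 f)
  end.

Lemma evZD e c f g :
  ev e (fun a => c * f a + g a) = fun a => c * ev e f a + ev e g a.
Proof.
elim: e f g => [[i|i]|d|e1 IH1 e2 IH2|e1 IH1 e2 IH2] f g /=; last first.
- by rewrite IH2 IH1.
- by apply/funext => a; rewrite IH1 IH2 mulrDr addrACA.
all: by apply/funext => a; rewrite mulrDr mulrCA.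
Qed.

Lemma evD e f g : ev e (fun a => f a + g a) = fun a => ev e f a + ev e g a.
Proof.
have := evZD e 1 f g; under [X in ev e X]eq_fun do rewrite mul1r.
by move=> ->; apply/funext => a; rewrite mul1r.
Qed.

Lemma evZ e c f : ev e (fun a => c * f a) = fun a => c * ev e f a.
Proof.
have ev0 : ev e (fun=> 0) = fun=> 0.
  have := evZD e (-1) (fun=> 0) (fun=> 0).
  under [X in ev e X]eq_fun do rewrite mulr0 addr0.
  by move=> ->; apply/funext => a; rewrite mulN1r addNr.
have := evZD e c f (fun=> 0).
under [X in ev e X]eq_fun do rewrite addr0.
by move=> ->; apply/funext => a; rewrite ev0 addr0.
Qed.

(** Lowering the i-th exponent by one changes [twist j] only when [i] is below [j],
    and then by the factor [(q j i)^-1].  So for distinct [i] and [j] exactly one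
    side picks up a factor: it equals [q i j] on the left, and cancels [q i j] on
    the right. *)
Lemma ev_comm i j f :
  ev (Mul (Gen (inl i)) (Gen (inl j))) f =
  ev (Mul (Scal (q i j)) (Mul (Gen (inl j)) (Gen (inl i)))) f.
Proof.
apply/funext => a /=; rewrite !twist_shift shiftC !mulrA; congr (_ * _).
have [->|ij] := eqVneq i j; first by rewrite lt_irr q_diag mul1r.
have := lt_total ij; case: (boolP (lt i j)) => [/lt_asym -> _|_ /= ->].
  by rewrite mulr1 exprN1 -q_inv mulrC [twist i a * _]mulrC mulrA.
by rewrite mulr1 exprN1 -(mulrA (q i j)) [q i j * _]mulrC mulfK // mulrC.
Qed.

Lemma ev_cong e1 e2 : cong (lrel q) e1 e2 -> ev e1 = ev e2.
Proof.
elim=> {e1 e2} /=.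
- move=> _ _ [i j|i|i]; apply/funext => f; first exact: ev_comm.
  + apply/funext => a /=.
    by rewrite twist_shift lt_irr mulr1 shiftK mulrA divff ?twist_neq0.
  + apply/funext => a /=.
    rewrite twist_shift lt_irr mulr1 -{2}[1]opprK shiftC shiftK.
    by rewrite mulrA mulVf ?twist_neq0.
- by [].
- by [].
- by move=> ? ? ? _ -> _ ->.
- by move=> ? ? ? ? _ -> _ ->.
- by move=> ? ? ? ? _ -> _ ->.
all: move=> *; apply/funext => f; rewrite ?evD ?evZ; apply/funext => a /=.
all: by rewrite ?(addrA, mul0r, add0r, mul1r, mulrDl, mulrA) // addrC.
Qed.

Definition act (u : quantum_laurent q) : (exponent -> K) -> exponent -> K := ev (rep u).

Lemma actE e : act (cls _ e) = ev e.
Proof. exact/ev_cong/rep_cls. Qed.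

Lemma actD u v f a : act (u + v) f a = act u f a + act v f a.
Proof.
by elim/cls_ind: u => x; elim/cls_ind: v => y; rewrite -[cls _ x + _]clsD !actE.
Qed.

Lemma actM u v f : act (u * v) f = act u (act v f).
Proof.
by elim/cls_ind: u => x; elim/cls_ind: v => y; rewrite -[cls _ x * _]clsM !actE.
Qed.

Lemma actZ c u f a : act (c *: u) f a = c * act u f a.
Proof. by elim/cls_ind: u => x; rewrite -[_ *: cls _ x]cls_scalM !actE. Qed.

Lemma laurent_oner_neq0 : 1 != 0 :> quantum_laurent q.
Proof.
apply/eqP => e; have : act 1 (fun=> 1) [fsfun] = act 0 (fun=> 1) [fsfun].
  by rewrite e.
by rewrite !actE /= mul0r mulr1 => /eqP; rewrite oner_eq0.
Qed.

(** Acting on the indicator function of the zero exponent lists the coefficients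
    of [u] in the basis of ordered monomials. *)
Definition qcoef (u : quantum_poly q) (a : exponent) : K :=
  act (qtoL u) (fun b => (b == [fsfun])%:R) a.

Lemma qcoefD u v a : qcoef (u + v) a = qcoef u a + qcoef v a.
Proof. by rewrite /qcoef raddfD actD. Qed.

Lemma qcoefZ c u a : qcoef (c *: u) a = c * qcoef u a.
Proof. by rewrite /qcoef qtoLZ actZ. Qed.

Lemma qcoef_varM i u a :
  qcoef (qvar q i * u) a = twist i a * qcoef u (shift i (-1) a).
Proof.
by rewrite /qcoef rmorphM /= qtoL_var actM actE.
Qed.

Lemma qcoef1 a : qcoef 1 a = (a == [fsfun])%:R.
Proof. by rewrite /qcoef rmorph1 actE /= mul1r. Qed.

(** Monomials are indexed by arbitrary words, not by exponents: multiplication is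
    then concatenation, and two words of the same exponent give proportional
    elements. *)
Definition mono (s : seq I) : quantum_poly q := \prod_(i <- s) qvar q i.

Lemma mono_cat s t : mono (s ++ t) = mono s * mono t.
Proof. exact: big_cat. Qed.

Lemma mono_cons i s : mono (i :: s) = qvar q i * mono s.
Proof. exact: big_cons. Qed.

Lemma qcoef_mono_neq0 s a :
  qcoef (mono s) a != 0 <-> forall i, a i = (count_mem i s)%:Z.
Proof.
elim: s a => [|k s IH] a.
  rewrite [mono _]big_nil qcoef1; split => [|h].
    by have [-> _ i|_] := eqVneq a [fsfun]; rewrite ?eqxx // fsfunE.
  suff -> : a = [fsfun] by rewrite eqxx oner_neq0.
  by apply/fsfunP => i; rewrite h fsfunE.
rewrite mono_cons qcoef_varM mulf_eq0 (negPf (twist_neq0 _ _)) /=.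
split=> [/IH h i|h].
  have := h i; rewrite shiftE eq_sym; case: eqP => //= _.
    by rewrite add1n -addn1 PoszD => <-; rewrite addrNK.
  by rewrite addr0.
apply/IH => i; rewrite shiftE h /= eq_sym; case: eqP => //= _.
  by rewrite add1n -addn1 PoszD addrK.
by rewrite addr0.
Qed.

Definition exponent_of (s : seq I) : exponent := foldr (shift^~ 1) [fsfun] s.

Lemma exponent_ofE s i : exponent_of s i = (count_mem i s)%:Z.
Proof.
elim: s => [|k s IH] /=; first by rewrite fsfunE.
rewrite shiftE IH eq_sym; case: eqP => _; last by rewrite addr0.
by rewrite add1n -addn1 PoszD.
Qed.

(** Linear independence of the monomials: the coefficient at the exponent of [t]
    vanishes on every word except the rearrangements of [t]. *)
Lemma qcoef_word_neq0 s t : (qcoef (mono s) (exponent_of t) != 0) = perm_eq s t.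
Proof.
apply/idP/idP => [/qcoef_mono_neq0 h|/permP st].
  apply/allP => i _ /=; have := h i; rewrite exponent_ofE => -[->] //.
by apply/qcoef_mono_neq0 => i; rewrite exponent_ofE st.
Qed.

End LaurentAction.

(** * Reordering words *)

Section Reordering.
Variables (K : fieldType) (I : choiceType) (q : I -> I -> K).
Hypothesis q_neq0 : forall i j, q i j != 0.
Local Notation mono := (mono q).

Definition comm_scalar (s : seq I) (k : I) : K := \prod_(i <- s) q i k.

Lemma comm_scalar_neq0 s k : comm_scalar s k != 0.
Proof. by rewrite prodf_seq_neq0; apply/allP => i _; rewrite q_neq0. Qed.

Lemma mono_var s k : mono s * qvar q k = comm_scalar s k *: (qvar q k * mono s).
Proof.
elim: s => [|i s IH].
  by rewrite /mono /comm_scalar !big_nil mul1r mulr1 scale1r.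
rewrite mono_cons -mulrA IH qpoly_scalerAr mulrA qvarC.
rewrite qpoly_scalerAl scalerA -mulrA.
by rewrite /comm_scalar big_cons mulrC.
Qed.

Lemma mono_perm s t : perm_eq s t -> exists2 c, c != 0 & mono s = c *: mono t.
Proof.
elim: s t => [|i s IH] t st.
  move/perm_size: (st) => /esym/size0nil ->; exists 1; first exact: oner_neq0.
  by rewrite scale1r.
have it : i \in t by rewrite -(perm_mem st) inE eqxx.
case/splitPr: it st => t1 t2; rewrite perm_sym perm_catC /= perm_cons => st.
have {st} st : perm_eq s (t1 ++ t2) by rewrite perm_sym perm_catC.
have [c c0 e] := IH _ st.
exists (c / comm_scalar t1 i); first by rewrite mulf_neq0 ?invr_eq0 ?comm_scalar_neq0.
rewrite mono_cons e -cat1s catA !mono_cat [mono [:: i]]big_seq1 mono_var.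
rewrite qpoly_scalerAl scalerA divfK ?comm_scalar_neq0 //.
by rewrite qpoly_scalerAr mulrA.
Qed.

End Reordering.

(** * Monomial orders on words *)

Section Orders.
Variable I : choiceType.

(** An order on exponents pulled back to words, so that rearrangements of a word
    are the ties. *)
Record word_order (ltw : seq I -> seq I -> Prop) : Prop := WordOrder {
  wo_irr : forall s t, perm_eq s t -> ~ ltw s t;
  wo_total : forall s t, [\/ ltw s t, perm_eq s t | ltw t s];
  wo_trans : forall s t u, ltw s t -> ltw t u -> ltw s u;
  wo_perm : forall s s' t t',
    perm_eq s s' -> perm_eq t t' -> ltw s t -> ltw s' t';
  wo_cat : forall s t u, ltw s t -> ltw (s ++ u) (t ++ u)
}.

(** Leading terms for the reversed order are lowest terms, so every statement about
    leading terms also holds at the lower end. *)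
Lemma word_order_rev ltw : word_order ltw -> word_order (fun s t => ltw t s).
Proof.
case=> irr tot tr pe ct; split.
- by move=> s t st; apply: irr; rewrite perm_sym.
- by move=> s t; case: (tot s t); [exact: Or33|exact: Or32|exact: Or31].
- by move=> s t u st tu; exact: tr tu st.
- by move=> s s' t t' ss tt; exact: pe.
- by move=> s t u; exact: ct.
Qed.

Lemma wo_catl ltw s t u : word_order ltw -> ltw s t -> ltw (u ++ s) (u ++ t).
Proof.
by move=> wo st; apply: wo_perm (wo_cat wo u st); rewrite // perm_catC.
Qed.

Lemma wo_permr ltw s t t' : word_order ltw -> perm_eq t t' ->
  ltw s t -> ltw s t'.
Proof. by move=> wo; apply: wo_perm. Qed.

Lemma strict_well_order : exists lt : rel I,
  [/\ forall i j, lt i j -> lt j i = false,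
      forall i j, i != j -> lt i j || lt j i,
      transitive lt &
      forall P : I -> Prop, (exists i, P i) ->
        exists2 i, P i & forall j, lt j i -> ~ P j].
Proof.
have [R woR] := well_ordering_principle I.
have chR : wo_chain R predT by move=> A _; exact: woR.
have asymR i j : R i j -> R j i -> i = j.
  by move=> ij ji; apply: (wo_chain_antisymmetric chR) => //; rewrite ij.
have totR i j : R i j || R j i by exact: (wo_chainW chR).
have minR (P : I -> Prop) : (exists i, P i) ->
    exists2 i, P i & forall j, P j -> R i j.
  case=> i Pi; have [|m [[Pm hm] _]] := woR [pred x | `[< P x >]].
    by exists i; apply/asboolP.
  by exists m => [|j /asboolP]; [exact/asboolP|exact: hm].
exists (fun i j => ~~ R j i); split.
- by move=> i j ji; have := totR j i; rewrite (negPf ji) /= => ->.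
- move=> i j; apply: contraNT; rewrite negb_or !negbK => /andP[ji ij].
  by apply/eqP; exact: asymR.
- move=> j i k ji kj; apply/negP => ki.
  have [|m hm h] := minR (fun x => [\/ x = i, x = j | x = k]).
    by exists i; exact: Or31.
  have [mi mj mk] := And3 (h i (Or31 _ _ erefl)) (h j (Or32 _ _ erefl))
    (h k (Or33 _ _ erefl)).
  case: hm => e; subst m; last by rewrite mj in kj.
    by move: kj; rewrite (asymR _ _ ki mk) mj.
  by rewrite mi in ji.
move=> P /minR[i Pi h]; exists i => // j ji /h ij.
by rewrite ij in ji.
Qed.

Definition lexw (lt : rel I) (s t : seq I) : Prop :=
  exists2 i, (count_mem i s < count_mem i t)%N &
    forall j, lt j i -> count_mem j s = count_mem j t.

(** Well-foundedness of the order on variables makes the lexicographic order total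
    when there are infinitely many variables: the first variable at which two
    words differ exists. *)
Lemma lexw_order (lt : rel I) :
  (forall i j, lt i j -> lt j i = false) ->
  (forall i j, i != j -> lt i j || lt j i) ->
  transitive lt ->
  (forall P : I -> Prop, (exists i, P i) ->
        exists2 i, P i & forall j, lt j i -> ~ P j) ->
  word_order (lexw lt).
Proof.
move=> asym tot tr wf; split.
- by move=> s t /permP st [i]; rewrite st ltnn.
- move=> s t; have [/wf[i]|h] :=
    pselect (exists i, count_mem i s != count_mem i t).
    rewrite neq_ltn => /orP[] ist h; [apply: Or31|apply: Or33]; exists i => //.
      by move=> j /h /negP/negPn/eqP.
    by move=> j /h /negP/negPn/eqP.
  apply: Or32; apply/allP => i _ /=; apply/negPn/negP => e; apply: h.
  by exists i.
- move=> s t u [i ist hi] [j jtu hj].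
  have [ij|ij] := eqVneq i j.
    subst j; exists i; first exact: ltn_trans ist jtu.
    by move=> k ki; rewrite hi ?hj.
  have /orP[{}ij|ji] := tot _ _ ij.
    exists i; first by rewrite -hj.
    by move=> k ki; rewrite hi // hj // (tr _ _ _ ki ij).
  exists j; first by rewrite hi.
  by move=> k kj; rewrite hi ?hj // (tr _ _ _ kj ji).
- move=> s s' t t' /permP ss /permP tt [i ist h]; exists i; first by rewrite -ss -tt.
  by move=> j /h; rewrite -ss -tt.
- move=> s t u [i ist h]; exists i; first by rewrite !count_cat ltn_add2r.
  by move=> j /h e; rewrite !count_cat e.
Qed.

End Orders.

(** * Leading terms *)

Section Leading.
Variables (K : fieldType) (I : choiceType) (q : I -> I -> K).
Hypothesis q_neq0 : forall i j, q i j != 0.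
Local Notation R := (quantum_poly q).
Local Notation mono := (mono q).

(** [C u t] stands for the coefficient of [u] at the exponent of [t];
    [Cmono] expresses the linear independence of the monomials. *)
Variable C : R -> seq I -> K.
Hypothesis CD : forall u v s, C (u + v) s = C u s + C v s.
Hypothesis CZ : forall c u s, C (c *: u) s = c * C u s.
Hypothesis Cmono : forall s t, (C (mono s) t != 0) = perm_eq s t.

Lemma C0 s : C 0 s = 0.
Proof. by rewrite -[0](scale0r 0) CZ mul0r. Qed.

Inductive span (P : seq I -> Prop) : R -> Prop :=
  | span0 : span P 0
  | spanD u v : span P u -> span P v -> span P (u + v)
  | spanM c s : P s -> span P (c *: mono s).

Lemma sub_span (P P' : seq I -> Prop) u :
  (forall s, P s -> P' s) -> span P u -> span P' u.
Proof. by move=> PP; elim=> *; [exact: span0|exact: spanD|apply/spanM/PP]. Qed.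

Lemma span_scale P c u : span P u -> span P (c *: u).
Proof.
elim=> [|v w _ hv _ hw|d s Ps].
- by rewrite scaler0; exact: span0.
- by rewrite scalerDr; exact: spanD.
by rewrite scalerA; exact: spanM.
Qed.

Lemma span_mul (P P' T : seq I -> Prop) u v :
  (forall s t, P s -> P' t -> T (s ++ t)) ->
  span P u -> span P' v -> span T (u * v).
Proof.
move=> PPT; elim=> [|u1 u2 _ IH1 _ IH2|c s Ps] sv.
- by rewrite mul0r; exact: span0.
- by rewrite mulrDl; apply: spanD; [exact: IH1|exact: IH2].
elim: sv => [|v1 v2 _ IH1 _ IH2|d t Pt].
- by rewrite mulr0; exact: span0.
- by rewrite mulrDr; exact: spanD.
rewrite qpoly_scalerAl qpoly_scalerAr.
by rewrite scalerA -mono_cat; apply/spanM/PPT.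
Qed.

Lemma span_full u : span xpredT u.
Proof.
elim/cls_ind: u => e; elim: e => [i|c|e1 h1 e2 h2|e1 h1 e2 h2].
- rewrite (_ : cls _ _ = 1 *: mono [:: i]); first exact: spanM.
  by rewrite scale1r /mono big_seq1.
- rewrite (_ : cls _ _ = c *: mono [::]); first exact: spanM.
  by rewrite /mono big_nil [LHS]cls_scal.
- by rewrite [cls _ _]clsD; exact: spanD.
- by rewrite [cls _ _]clsM; exact: span_mul h1 h2.
Qed.

Lemma span_coef0 (P : seq I -> Prop) u s :
  span P u -> (forall t, P t -> ~~ perm_eq t s) -> C u s = 0.
Proof.
move=> Pu h; elim: Pu => [|v w _ IHv _ IHw|c t /h].
- exact: C0.
- by rewrite CD IHv IHw addr0.
by rewrite CZ -Cmono negbK => /eqP ->; rewrite mulr0.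
Qed.

Definition comb (l : seq (K * seq I)) : R := \sum_(p <- l) p.1 *: mono p.2.

Lemma span_comb P u : span P u -> exists l : seq (K * seq I), u = comb l.
Proof.
elim=> [|v w _ [l1 ->] _ [l2 ->]|c s _].
- by exists [::]; rewrite /comb big_nil.
- by exists (l1 ++ l2); rewrite /comb big_cat.
- by exists [:: (c, s)]; rewrite /comb big_seq1.
Qed.

Lemma comb_span (P : seq I -> Prop) l :
  (forall p, p \in l -> P p.2) -> span P (comb l).
Proof.
rewrite /comb; elim: l => [|p l IH] h; first by rewrite big_nil; exact: span0.
rewrite big_cons; apply: spanD.
  by apply: spanM; apply: h; rewrite inE eqxx.
by apply: IH => r rl; apply: h; rewrite inE rl orbT.
Qed.

Section OneOrder.
Variable ltw : seq I -> seq I -> Prop.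
Hypothesis wo : word_order ltw.

Definition lead (u : R) (c : K) (s : seq I) : Prop :=
  c != 0 /\ exists2 v, span (ltw^~ s) v & u = c *: mono s + v.

Lemma max_word (p : K * seq I) l : exists2 m, m \in p :: l &
  forall r, r \in p :: l -> ltw r.2 m.2 \/ perm_eq r.2 m.2.
Proof.
elim: l p => [|p' l IH] p.
  by exists p; rewrite ?inE // => r; rewrite inE => /eqP ->; right.
have [m ml hm] := IH p'.
have [h|h|h] := wo_total wo p.2 m.2.
- exists m; first by rewrite inE ml orbT.
  by move=> r; rewrite inE => /predU1P[->|/hm]; [left|].
- exists m; first by rewrite inE ml orbT.
  by move=> r; rewrite inE => /predU1P[->|/hm]; [right|].
exists p; first by rewrite inE eqxx.
move=> r; rewrite inE => /predU1P[->|/hm[rm|rm]]; first by right.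
  by left; exact: wo_trans rm h.
by left; apply: wo_perm h; rewrite // perm_sym.
Qed.

Lemma comb_perm s l : (forall p, p \in l -> perm_eq p.2 s) ->
  exists c, comb l = c *: mono s.
Proof.
rewrite /comb; elim: l => [|p l IH] h.
  by exists 0; rewrite big_nil scale0r.
have [|c e] := IH; first by move=> r rl; apply: h; rewrite inE rl orbT.
have [|d _ e'] := @mono_perm _ _ q q_neq0 p.2 s.
  by apply: h; rewrite inE eqxx.
by exists (p.1 * d + c); rewrite big_cons e e' scalerA scalerDl.
Qed.

(** Among the terms of a finite expression of [u], those of maximal exponent are
    proportional to one monomial.  If they cancel, a shorter expression of [u]
    remains; otherwise they form the leading term. *)
Lemma lead_exists u : u != 0 -> exists c s, lead u c s.
Proof.
have [l ->] := span_comb (span_full u).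
have [n] := ubnP (size l); elim: n l => // n IH [|p l].
  by rewrite /comb big_nil eqxx.
move=> ln; have [m ml hm] := max_word p l.
set L := p :: l in ml hm ln *.
pose top := [seq r <- L | perm_eq r.2 m.2].
pose low := [seq r <- L | ~~ perm_eq r.2 m.2].
have e : comb L = comb top + comb low.
  by rewrite /comb !big_filter [LHS](bigID (fun r => perm_eq r.2 m.2)).
have [|c et] := @comb_perm m.2 top.
  by move=> r; rewrite mem_filter => /andP[].
have [c0|c0] := eqVneq c 0.
  rewrite e et c0 scale0r add0r; apply: IH.
  apply: leq_trans (_ : _ <= size L)%N _; last by [].
  rewrite size_filter -[leqRHS](count_predC (fun r => perm_eq r.2 m.2)).
  rewrite -add1n leq_add2r -has_count; apply/hasP; exists m => //.
move=> _; exists c, m.2; split=> //; exists (comb low); last by rewrite e et.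
apply: comb_span => r; rewrite mem_filter => /andP[nrm /hm[]//].
by move/negP: nrm.
Qed.

Lemma span_below_coef v s t :
  span (ltw^~ s) v -> ltw s t \/ perm_eq s t -> C v t = 0.
Proof.
move=> vs st; apply: (span_coef0 vs) => r rs; apply/negP => rt.
have : ltw s r \/ perm_eq s r.
  case: st => st; [left; apply: wo_permr st => //|right].
    by rewrite perm_sym.
  by apply: perm_trans st _; rewrite perm_sym.
case=> [sr|sr]; last by apply: (wo_irr wo _ rs); rewrite perm_sym.
by apply: (wo_irr wo (perm_refl r)); exact: (wo_trans wo rs sr).
Qed.

Lemma lead_coef_above u c s t : lead u c s -> ltw s t -> C u t = 0.
Proof.
move=> [_ [v vs ->]] st; rewrite CD CZ (span_below_coef vs) ?addr0; last by left.
suff /eqP -> : C (mono s) t == 0 by rewrite mulr0.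
by apply/negPn; rewrite Cmono; apply/negP => /(wo_irr wo).
Qed.

Lemma lead_coefE u c s t : lead u c s -> perm_eq s t -> C u t = c * C (mono s) t.
Proof.
move=> [_ [v vs ->]] st; rewrite CD CZ (span_below_coef vs) ?addr0 //.
by right.
Qed.

Lemma lead_coef_neq0 u c s t : lead u c s -> perm_eq s t -> C u t != 0.
Proof.
move=> us st; rewrite (lead_coefE us st) mulf_neq0 ?Cmono //.
by case: us.
Qed.

Lemma lead_neq0 u c s : lead u c s -> u != 0.
Proof.
move=> us; apply/eqP => u0; have := lead_coef_neq0 us (perm_refl s).
by rewrite u0 C0 eqxx.
Qed.

Lemma lead_perm u c s d t : lead u c s -> lead u d t -> perm_eq s t.
Proof.
move=> us ut; case: (wo_total wo s t) => // st.
  have := lead_coef_neq0 ut (perm_refl t).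
  by rewrite (lead_coef_above us st) eqxx.
have := lead_coef_neq0 us (perm_refl s).
by rewrite (lead_coef_above ut st) eqxx.
Qed.

Lemma lead_term u c s d t : lead u c s -> lead u d t ->
  c *: mono s = d *: mono t.
Proof.
move=> us ut; have st := lead_perm us ut.
have [l _ e] := mono_perm q_neq0 st.
rewrite e scalerA; congr (_ *: _).
have h : C (mono t) t != 0 by rewrite Cmono.
apply: (mulIf h); rewrite -(lead_coefE ut (perm_refl t)) (lead_coefE us st) e CZ.
by rewrite mulrA.
Qed.

Lemma lead_mul u c s v d t :
  lead u c s -> lead v d t -> lead (u * v) (c * d) (s ++ t).
Proof.
move=> [c0 [u' us ->]] [d0 [v' vt ->]]; split; first by rewrite mulf_neq0.
exists (c *: mono s * v' + u' * (d *: mono t + v')).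
  apply: spanD.
    apply: (@span_mul (eq s) (ltw^~ t)) => //; last exact: spanM.
    by move=> _ r <- rt; exact: wo_catl.
  apply: (@span_mul (ltw^~ s) (fun r => r = t \/ ltw r t)) => //.
    move=> r r' rs [->|rt]; first exact: wo_cat.
    by apply: (wo_trans wo (wo_catl r wo rt)); exact: wo_cat.
  by apply: spanD; [apply: spanM; left|apply: sub_span vt => ?; right].
rewrite mulrDl addrA mulrDr; congr (_ + _ + _).
rewrite qpoly_scalerAl qpoly_scalerAr.
by rewrite scalerA mono_cat.
Qed.

Lemma lead_mono s : lead (mono s) 1 s.
Proof.
split; first exact: oner_neq0.
by exists 0; [exact: span0|rewrite scale1r addr0].
Qed.

Lemma lead_scale g u c s : g != 0 -> lead u c s -> lead (g *: u) (g * c) s.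
Proof.
move=> g0 [c0 [v vs ->]]; split; first by rewrite mulf_neq0.
by exists (g *: v); [exact: span_scale|rewrite scalerDr scalerA].
Qed.

(** The product of the leading terms is a nonzero leading term of the product. *)
Lemma quantum_poly_domain (u v : R) : u != 0 -> v != 0 -> u * v != 0.
Proof.
move=> /lead_exists[c [s us]] /lead_exists[d [t vt]].
exact: lead_neq0 (lead_mul us vt).
Qed.

End OneOrder.

(** If the highest and the lowest exponents of [u] agree, nothing lies strictly
    above, below or beside them: subtracting the leading term leaves an element
    all of whose coefficients vanish. *)
Lemma lead_both ltw u c d s t : word_order ltw ->
  lead ltw u c s -> lead (fun a b => ltw b a) u d t -> perm_eq s t ->
  u = c *: mono s.
Proof.
move=> wo us ut st; apply/eqP; rewrite -subr_eq0 -scaleN1r; apply/negPn/negP.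
have wo' := word_order_rev wo.
set w := (_ + _) => w0; have [e [r wr]] := lead_exists wo w0.
have := lead_coef_neq0 wo wr (perm_refl r).
suff -> : C w r = 0 by rewrite eqxx.
rewrite CD 2!CZ; case: (wo_total wo s r) => sr.
- rewrite (lead_coef_above wo us sr) add0r.
  suff /eqP -> : C (mono s) r == 0 by rewrite !mulr0.
  by apply/negPn; rewrite Cmono; apply/negP => /(wo_irr wo).
- by rewrite (lead_coefE wo us sr) mulN1r subrr.
have rt : ltw r t by exact: wo_permr st sr.
rewrite (lead_coef_above wo' ut rt) add0r.
suff /eqP -> : C (mono s) r == 0 by rewrite !mulr0.
apply/negPn; rewrite Cmono; apply/negP; rewrite perm_sym.
by move=> /(wo_irr wo).
Qed.

End Leading.

(** * From a Martindale quotient to an equation in the ring *)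

(** Let [x] be in the domain of [w] with [y = w x] nonzero.  Computing
    [w (x * sigma r * x)] by left linearity gives [x * sigma r * y]; writing
    the last factor as [sigma x'] and using that [w] twists right multiplication
    by [sigma] gives [y * r * x'].  The identity [w (x * sigma r) = w x * r] is
    given on an ideal depending on [r]; multiplying by a nonzero element of
    that ideal and cancelling extends it to the whole domain of [w]. *)
Lemma X_inner_intertwiner (R : pzRingType) (sigma : {rmorphism R -> R}) :
  (forall u v : R, u != 0 -> v != 0 -> u * v != 0) ->
  bijective sigma -> X_inner sigma ->
  exists x y x', [/\ x != 0, y != 0, sigma x' = x &
    forall r, x * sigma r * y = y * r * x'].
Proof.
move=> dom [sigmaV _ sigmaVK] [w [_ w_neq0 wP]].
have wE r x : lm_dom w x -> w (x * sigma r) = w x * r.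
  move=> wx; have [J [[_ _ _ Jr [j Jj j0]] Jw _ hJ]] := wP r.
  have [_ _ _ wr _] := lm_ideal w.
  (* [j * x] lies in the ideal [J] on which the identity is given. *)
  have e : j * (w (x * sigma r) - w x * r) = 0.
    rewrite mulrBr -(lm_lin _ (wr _ _ wx)) !mulrA -(lm_lin _ wx).
    by rewrite [X in X - _](hJ _ (Jr _ x Jj)) subrr.
  apply/eqP; rewrite -subr_eq0; apply: contraT => /(dom _ _ j0).
  by rewrite e eqxx.
have [x [wx y0]] : exists x, lm_dom w x /\ w x != 0.
  apply: contrapT => h; apply: w_neq0; exists (lm_dom w); split=> //.
    exact: lm_ideal.
  move=> x wx; rewrite mulr0; apply/eqP; apply: contraT => y0.
  by case: h; exists x.
exists x, (w x), (sigmaV x); split=> //.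
  apply: contraNneq y0 => x0; have [w0 _ _ _ _] := lm_ideal w.
  by rewrite x0 -[0](mulr0 0) (lm_lin _ w0) !mul0r.
move=> r; rewrite -(lm_lin _ wx) -mulrA -{2}[x]sigmaVK -rmorphM wE //.
by rewrite mulrA.
Qed.

(** * Conjugation by Laurent monomials *)

Section Conjugation.
Variables (K : fieldType) (I : Type) (q : I -> I -> K).
Hypothesis q_neq0 : forall i j, q i j != 0.
Local Notation L := (quantum_laurent q).

Lemma expr_qcomm (u v : L) c n :
  u * v = c *: (v * u) -> u ^+ n * v = c ^+ n *: (v * u ^+ n).
Proof.
move=> uv; elim: n => [|n IH]; first by rewrite !expr0 mul1r mulr1 scale1r.
rewrite exprSr -mulrA uv qlaurent_scalerAr mulrA IH qlaurent_scalerAl scalerA.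
by rewrite -mulrA -exprS.
Qed.

Lemma lvarV_qcomm i k :
  lvarV q i * lvar q k = (q i k)^-1 *: (lvar q k * lvarV q i).
Proof.
rewrite -[X in X * lvar q k]mulr1.
have -> : lvar q k * lvarV q i = q i k *: (lvarV q i * lvar q k).
  rewrite -[X in X * lvarV q i]mul1r -(lvarVK q i) -[_ * lvar q i * lvar q k]mulrA.
  rewrite lvarC qlaurent_scalerAr qlaurent_scalerAl.
  by rewrite -!mulrA lvarK mulr1.
by rewrite scalerA mulVf // scale1r mulr1.
Qed.

Lemma lvarX_qcomm i j k :
  lvarX q i j * lvar q k = q i k ^ j *: (lvar q k * lvarX q i j).
Proof.
case: j => n /=; first exact/expr_qcomm/lvarC.
by rewrite NegzE -exprnN -exprVn; exact/expr_qcomm/lvarV_qcomm.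
Qed.

Lemma lmon_conj_var l k :
  lmon q l * lvar q k * lmonV q l =
  (\prod_(p <- l) q p.1 k ^ p.2) *: lvar q k.
Proof.
have -> : lmon q l * lvar q k =
    (\prod_(p <- l) q p.1 k ^ p.2) *: (lvar q k * lmon q l).
  rewrite /lmon; elim: l => [|p l IH].
    by rewrite !big_nil mul1r mulr1 scale1r.
  rewrite !big_cons -mulrA IH qlaurent_scalerAr mulrA lvarX_qcomm.
  by rewrite qlaurent_scalerAl scalerA mulrC mulrA.
by rewrite qlaurent_scalerAl -mulrA lmonK mulr1.
Qed.

(** Both sides are multiplicative and additive in [s], so it suffices to compare them
    on scalars and variables. *)
Lemma diagonal_conj l (sigma : {rmorphism quantum_poly q -> quantum_poly q}) :
  (forall c, sigma (c *: (1 : quantum_poly q)) = c *: (1 : quantum_poly q)) ->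
  (forall k, sigma (qvar q k) = (\prod_(p <- l) q p.1 k ^ p.2) *: qvar q k) ->
  forall s, qtoL (sigma s) = lmon q l * qtoL s * lmonV q l.
Proof.
move=> sc sv; elim/cls_ind; elim=> [k|c|e1 h1 e2 h2|e1 h1 e2 h2].
- by rewrite sv qtoLZ qtoL_var lmon_conj_var.
- have -> : cls (qrel q) (Scal c) = c *: (1 : quantum_poly q) by exact: cls_scal.
  rewrite sc qtoLZ rmorph1 qlaurent_scalerAr mulr1 qlaurent_scalerAl.
  by rewrite lmonK.
- have -> : cls (qrel q) (Add e1 e2) = cls _ e1 + cls _ e2 by exact: clsD.
  by rewrite !rmorphD mulrDr mulrDl /= h1 h2.
have -> : cls (qrel q) (Mul e1 e2) = cls _ e1 * cls _ e2 by exact: clsM.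
rewrite !rmorphM /= h1 h2 -!mulrA; congr (_ * (_ * _)).
by rewrite !mulrA lmonVK mul1r.
Qed.

End Conjugation.

(** * X-inner automorphisms are diagonal *)

Section XInner.
Variables (K : fieldType) (I : choiceType) (q : I -> I -> K).
Hypothesis q_neq0 : forall i j, q i j != 0.
Hypothesis q_diag : forall i, q i i = 1.
Hypothesis q_inv : forall i j, q i j = (q j i)^-1.
Variable sigma : {rmorphism quantum_poly q -> quantum_poly q}.
Hypothesis sigma_bij : bijective sigma.
Local Notation R := (quantum_poly q).
Local Notation mono := (mono q).

Lemma word_coefficients : exists C : R -> seq I -> K,
  [/\ forall u v s, C (u + v) s = C u s + C v s,
      forall c u s, C (c *: u) s = c * C u s &
      forall s t, (C (mono s) t != 0) = perm_eq s t].
Proof.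
have [lt [asym tot _ _]] := strict_well_order I.
exists (fun u s => qcoef lt u (exponent_of s)); split.
- by move=> u v s; rewrite qcoefD.
- by move=> c u s; rewrite qcoefZ.
- by move=> s t; rewrite qcoef_word_neq0.
Qed.

Lemma word_order_exists : exists ltw : seq I -> seq I -> Prop, word_order ltw.
Proof.
have [lt [asym tot tr wf]] := strict_well_order I.
by exists (lexw lt); exact: lexw_order.
Qed.

Lemma sigma_neq0 (u : R) : u != 0 -> sigma u != 0.
Proof. by rewrite -{2}(rmorph0 sigma) (inj_eq (bij_inj sigma_bij)). Qed.

(** For [r = 1] the equation shows that [x] and [x'] have the same leading exponent;
    cancelling it and that of [y] in the general equation leaves the leading
    exponents of [sigma r] and [r]. *)
Lemma intertwiner_lead x y x' ltw r c s : word_order ltw ->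
  x != 0 -> y != 0 -> sigma x' = x ->
  (forall r, x * sigma r * y = y * r * x') ->
  lead ltw r c s -> exists d t, lead ltw (sigma r) d t /\ perm_eq t s.
Proof.
have [C [CD CZ Cm]] := word_coefficients.
move=> wo x0 y0 xx' xy rs.
have x'0 : x' != 0 by apply: contraNneq x0 => e; rewrite -xx' e rmorph0.
have r0 := lead_neq0 CD CZ Cm wo rs.
have [a [sx hx]] := lead_exists q_neq0 wo x0.
have [b [sy hy]] := lead_exists q_neq0 wo y0.
have [a' [sx' hx']] := lead_exists q_neq0 wo x'0.
have [d [t ht]] := lead_exists q_neq0 wo (sigma_neq0 r0).
exists d, t; split=> //.
have e1 : x * y = y * x' by have := xy 1; rewrite rmorph1 !mulr1.
have h1 := lead_mul wo hx hy; rewrite e1 in h1.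
have /permP p1 := lead_perm CD CZ Cm wo h1 (lead_mul wo hy hx').
have h2 := lead_mul wo (lead_mul wo hx ht) hy; rewrite xy in h2.
have /permP p2 := lead_perm CD CZ Cm wo h2 (lead_mul wo (lead_mul wo hy rs) hx').
apply/permP => P; have := p1 P; have := p2 P; rewrite !count_cat => P2 P1.
apply: (@addnI (count P sx + count P sy)%N).
by rewrite addnAC P2 P1 addnAC.
Qed.

(** A monomial is both its highest and its lowest term, and [sigma] preserves both
    exponents, for an order and for its reverse. *)
Lemma intertwiner_mono x y x' s :
  x != 0 -> y != 0 -> sigma x' = x ->
  (forall r, x * sigma r * y = y * r * x') ->
  forall c, c != 0 -> exists g t, [/\ g != 0, perm_eq t s &
    sigma (c *: mono s) = g *: mono t].
Proof.
have [C [CD CZ Cm]] := word_coefficients.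
have [ltw wo] := word_order_exists.
have wo' := word_order_rev wo.
move=> x0 y0 xx' xy c c0.
have lc ltw' : lead ltw' (c *: mono s) (c * 1) s.
  by apply: lead_scale => //; exact: lead_mono.
have [d [t [h ts]]] := intertwiner_lead wo x0 y0 xx' xy (lc _).
have [d' [t' [h' ts']]] := intertwiner_lead wo' x0 y0 xx' xy (lc _).
exists d, t; split=> //; first by case: h.
apply: (lead_both q_neq0 CD CZ Cm wo h h').
by apply: perm_trans ts _; rewrite perm_sym.
Qed.

(** The words [s] and [t] are the leading words of [x] and [y].  With
    [sigma x_k = g x_k] known, the leading coefficients in
    [g x x_k y = y x_k x'] are compared with those in [x y = y x'], after x_k
    has been moved to the front past [s] on one side and past [t] on the
    other.  As [sigma] is a mere ring morphism, its value on scalars has to be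
    found too: [sigma c] is some scalar [g], and the equation for [r = c] reads
    [g (x y) = c (x y)]. *)
Lemma X_inner_diagonal : X_inner sigma ->
  (forall c, sigma (c *: (1 : quantum_poly q)) = c *: (1 : quantum_poly q)) /\
  exists s t : seq I, forall k,
    sigma (qvar q k) = (comm_scalar q t k / comm_scalar q s k) *: qvar q k.
Proof.
have [C [CD CZ Cm]] := word_coefficients.
have [ltw wo] := word_order_exists.
have dom := quantum_poly_domain q_neq0 CD CZ Cm wo.
move=> inn; have [x [y [x' [x0 y0 xx' xy]]]] :=
  X_inner_intertwiner dom sigma_bij inn.
have e1 : x * y = y * x' by have := xy 1; rewrite rmorph1 !mulr1.
have x'0 : x' != 0 by apply: contraNneq x0 => e; rewrite -xx' e rmorph0.
split=> [c|].
  have [->|c0] := eqVneq c 0; first by rewrite scale0r rmorph0.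
  have := intertwiner_mono ([::]) x0 y0 xx' xy c0.
  rewrite [mono [::]]big_nil => -[g [t [_ /perm_size/size0nil -> e]]].
  rewrite [mono [::]]big_nil in e.
  have := xy (c *: (1 : R)); rewrite e !qpoly_scalerAr !mulr1 !qpoly_scalerAl e1.
  move/eqP; rewrite -subr_eq0 -scalerBl => h.
  suff /eqP : g - c == 0 by move/eqP; rewrite subr_eq0 => /eqP ->.
  apply: contraTT h => gc; rewrite -[y * x']mul1r -qpoly_scalerAl.
  apply: (dom); last exact: dom.
  have := lead_neq0 CD CZ Cm wo (lead_scale gc (lead_mono q ltw [::])).
  by rewrite [mono [::]]big_nil.
have [a [s hx]] := lead_exists q_neq0 wo x0.
have [b [t hy]] := lead_exists q_neq0 wo y0.
have [a' [s' hx']] := lead_exists q_neq0 wo x'0.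
exists s, t => k.
have [g [r [g0 kr e]]] := intertwiner_mono ([:: k]) x0 y0 xx' xy (oner_neq0 K).
have er : r = [:: k] by apply: perm_small_eq.
rewrite er /mono big_seq1 scale1r in e.
rewrite e; congr (_ *: _).
have h1 := lead_mul wo hx hy; rewrite e1 in h1.
have E1 := lead_term q_neq0 CD CZ Cm wo h1 (lead_mul wo hy hx').
have hk := lead_mono q ltw [:: k]; rewrite /mono big_seq1 in hk.
have h2 := lead_mul wo (lead_mul wo hx hk) hy.
have h3 := lead_mul wo (lead_mul wo hy hk) hx'.
(* [y * x_k * x'] is also [g *: (x * x_k * y)], which gives it a second leading
   term. *)
have h4 := lead_scale g0 h2; rewrite -qpoly_scalerAl -qpoly_scalerAr -e xy in h4.
have mono_k u v : mono ((u ++ [:: k]) ++ v) = comm_scalar q u k *: mono (k :: u ++ v).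
  by rewrite !mono_cat [mono [:: k]]big_seq1 mono_var // qpoly_scalerAl -mulrA
             -mono_cat -mono_cons.
have := lead_term q_neq0 CD CZ Cm wo h4 h3; rewrite !mono_k !mulr1 !scalerA.
have -> : (b * a' * comm_scalar q t k) *: mono (k :: t ++ s') =
          (comm_scalar q t k * (a * b)) *: mono (k :: s ++ t).
  rewrite mulrC -!(scalerA (comm_scalar _ _ _)) ![mono (k :: _)]mono_cons.
  by rewrite -(qpoly_scalerAr (a * b)) -(qpoly_scalerAr (b * a')) E1.
move=> /(congr1 (fun u => C u (k :: s ++ t))); rewrite !CZ.
have nz : C (mono (k :: s ++ t)) (k :: s ++ t) != 0 by rewrite Cm.
have ab0 : a * b != 0 by case: h1.
move=> /(mulIf nz); rewrite mulrAC => /(mulIf ab0) <-.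
by rewrite mulfK // comm_scalar_neq0.
Qed.

End XInner.

Theorem proposition2p2 (K : fieldType) (I : Type) (q : I -> I -> K)
    (q_neq0 : forall i j, q i j != 0)
    (q_diag : forall i, q i i = 1)
    (q_inv : forall i j, q i j = (q j i)^-1)
    (sigma : {rmorphism quantum_poly q -> quantum_poly q})
    (sigma_bij : bijective sigma)
    (sigma_inner : X_inner sigma) :
  (exists l : seq (I * int), forall s : quantum_poly q,
     qtoL (sigma s) = lmon q l * qtoL s * lmonV q l) /\
  (forall l : seq (I * int),
     (forall s : quantum_poly q, qtoL (sigma s) = lmon q l * qtoL s * lmonV q l) ->
     forall k : I,
       sigma (qvar q k) = (\prod_(p <- l) (q p.1 k) ^ p.2) *: qvar q k).
Proof.
have [sigma_scal [s [t sigma_var]]] :=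
  @X_inner_diagonal K {classic I} q q_neq0 q_diag q_inv sigma sigma_bij
    sigma_inner.
split.
  exists ([seq (i, 1) | i <- t] ++ [seq (i, -1) | i <- s]).
  apply: diagonal_conj => // k; rewrite sigma_var; congr (_ *: _).
  rewrite big_cat !big_map /= /comm_scalar; congr (_ * _).
  by rewrite -prodfV; apply: eq_bigr => i _; rewrite exprN1.
move=> l hl k; rewrite sigma_var; congr (_ *: _).
have := hl (qvar q k); rewrite sigma_var qtoLZ qtoL_var lmon_conj_var //.
move=> /eqP; rewrite -subr_eq0 -scalerBl => /eqP h.
apply/eqP; rewrite -subr_eq0.
have := @laurent_oner_neq0 K {classic I} q.
have [lt [asym tot _ _]] := strict_well_order {classic I}.
move=> /(_ lt q_neq0 q_diag q_inv asym tot); apply: contraNT => c0.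
rewrite -(lvarK q k) -[lvar q k]scale1r -(mulVf c0) -scalerA h scaler0.
by rewrite mul0r.
Qed.
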